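(* Let $\mu\subset\mathbb{N}$ be an increasing sequence. There exists a sequence $a=(a_0,a_1,a_2,\dots)$ of real numbers such that, for every continuous real function $f$ on $(0,1)$, there exists an increasing sequence $(\lambda_n)\subset\mu$ such that $$\sum_{k=0}^{\lambda_n-1}\binom{\lambda_n}{k}a_k x^k(1-x)^{\lambda_n-k}\rightarrow f(x)\quad\text{as }n\rightarrow+\infty,$$ uniformly on every compact set in $(0,1)$. The set of such sequences $a$ is a dense $G_\delta$ subset of $\mathbb{R}^{\mathbb{N}}$ and contains, apart from $0$, a dense subspace.
   Context: $\mathbb{R}^{\mathbb{N}}$ carries the product topology. ''Increasing'' for index sequences means strictly increasing. A set contains a subspace apart from $0$ if it contains all its non-zero elements. *)

(* Defs.v *)
From HB Require Import structures.
From mathcomp Require Import all_boot all_order all_algebra.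
From mathcomp Require Import all_classical all_reals all_analysis.

Set Implicit Arguments.
Unset Strict Implicit.
Unset Printing Implicit Defensive.

Import Order.TTheory GRing.Theory Num.Theory.
Import numFieldNormedType.Exports.

Local Open Scope classical_set_scope.
Local Open Scope ring_scope.

(* The index k stops at n - 1: the term a n * x ^+ n is left out. *)
Definition bernstein_sum (R : realType) (a : nat -> R) (n : nat) (x : R) : R :=
  \sum_(k < n) 'C(n, k)%:R * a k * x ^+ k * (1 - x) ^+ (n - k).

(* {ptws nat -> R} is the function type nat -> R with the product topology.
   Functions on (0, 1) are represented by total functions on R whose values
   outside (0, 1) are irrelevant. *)
Definition universal_seqs (R : realType) (mu : nat -> nat)
    : set {ptws nat -> R} :=
  [set a : nat -> R |
    forall f : R -> R, {within `]0, 1[, continuous f} ->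
    exists2 lambda : nat -> nat,
      increasing_seq lambda /\ range lambda `<=` range mu &
      forall K : set R, compact K -> K `<=` `]0, 1[ ->
        {uniform K, (fun n => bernstein_sum a (lambda n)) @ \oo --> f}].

Arguments universal_seqs : clear implicits.

(* The vector space structure on nat -> R is the pointwise one; R^o is R seen
   as a module over itself. *)
Definition linear_subspace (R : realType) (V : set (nat -> R)) : Prop :=
  submod_closed ([in V] : {pred nat -> R^o}).

(* Main.v *)
Require Import Defs.
From HB Require Import structures.
From mathcomp Require Import all_boot all_order all_algebra.
From mathcomp Require Import all_classical all_reals all_analysis borel_hierarchy.
From mathcomp Require Import ring lra.
Import Order.TTheory GRing.Theory Num.Theory.
Import numFieldNormedType.Exports.
Local Open Scope classical_set_scope.
Local Open Scope ring_scope.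

(* Chebyshev's estimate for the binomial weights shows that, on compact subsets
   of (0, 1), the Bernstein sum of order n of a is close to g as soon as
   a k = g (k / n) except for boundedly many initial k, and n is large. Hence
   Bernstein sums with rational coefficients are dense in C(0, 1), so
   universality amounts to approximating countably many functions, which is a
   countable intersection of open conditions. For the dense subspace, cut nat
   into blocks [m t, m (t + 1)) with m (t + 1) in mu. Block t is devoted to one
   target q t and one coordinate j t: the sequence attached to a finitely
   supported c is c plus, on block t, c (j t) * q t (k / m (t + 1)). If every
   pair (target, coordinate) is used infinitely often, then this sequence is
   universal whenever c is nonzero. Being triangular in c, these sequences have
   arbitrary initial segments; density of the universal set follows. *)

(** * Moments of the binomial weights *)

Definition binomial_weight {R : comNzRingType} (n k : nat) (x : R) : R :=
  'C(n, k)%:R * x ^+ k * (1 - x) ^+ (n - k).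

(** Pascal's rule splits off the last trial: it fails with weight [1 - x] and keeps the centre [c],
    or succeeds with weight [x] and moves the centre to [c - 1]. Hence the induction is general in
    [c]. *)
Lemma binomial_weight_second_moment {R : comNzRingType} (n : nat) (x c : R) :
  \sum_(k < n.+1) binomial_weight n k x * (k%:R - c) ^+ 2
  = n%:R * x * (1 - x) + (n%:R * x - c) ^+ 2.
Proof.
elim: n c => [|n IHn] c.
  by rewrite big_ord_recl big_ord0 /binomial_weight bin0 /=; ring.
pose w k : R := binomial_weight n k x.
have step : \sum_(k < n.+2) binomial_weight n.+1 k x * (k%:R - c) ^+ 2
    = (1 - x) * (\sum_(k < n.+1) w k * (k%:R - c) ^+ 2)
      + x * (\sum_(k < n.+1) w k * (k%:R - (c - 1)) ^+ 2).
  rewrite !mulr_sumr big_ord_recl [X in _ = X + _]big_ord_recl /=.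
  have -> : \sum_(i < n.+1) binomial_weight n.+1 (bump 0 i) x
      * ((bump 0 i)%:R - c) ^+ 2
    = \sum_(i < n.+1) ((1 - x) * (w i.+1 * (i.+1%:R - c) ^+ 2)
       + x * (w i * (i%:R - (c - 1)) ^+ 2)).
    apply: eq_bigr => i _.
    rewrite /bump leq0n add1n /w /binomial_weight binS subSS.
    (* For [i = n] the truncated exponent [n - i.+1] is off by one, but there the factor
       ['C(n, i.+1)] is zero. *)
    have [ltin|] := ltnP i n.
      by rewrite -(subnSK ltin) natrD -natr1 !exprS; ring.
    rewrite -ltnS => lein.
    by rewrite bin_small // natrD -natr1 !exprS; ring.
  rewrite big_split /= addrA; congr (_ + _).
  rewrite /w /binomial_weight !bin0 !subn0 !expr0 exprS.
  rewrite big_ord_recr /= bin_small //.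
  under [in RHS]eq_bigr do rewrite /bump leq0n add1n.
  by ring.
by rewrite step !IHn -natr1; ring.
Qed.

Lemma binomial_weight_ge0 {R : realType} (n k : nat) (x : R) :
  0 <= x <= 1 -> 0 <= binomial_weight n k x.
Proof.
by move=> /andP[x0 x1]; rewrite !mulr_ge0 ?exprn_ge0 ?subr_ge0.
Qed.

Lemma sum_binomial_weight {R : realType} (n : nat) (x : R) :
  \sum_(k < n.+1) binomial_weight n k x = 1.
Proof.
have := exprDn (1 - x) x n; rewrite subrK expr1n => ->.
by apply: eq_bigr => k _; rewrite /binomial_weight -mulr_natl; ring.
Qed.

Lemma bernstein_sumE {R : realType} (a : nat -> R) (n : nat) (x : R) :
  bernstein_sum a n x =
  \sum_(k < n.+1) binomial_weight n k x * (if (k < n)%N then a k else 0).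
Proof.
rewrite big_ord_recr /= ltnn mulr0 addr0; apply: eq_bigr => k _.
by rewrite ltn_ord /binomial_weight; ring.
Qed.

(** The weights average the quadratic bound to a multiple of the variance [x * (1 - x) / n], which
    is at most [1 / n]. The omitted term [k = n] enters as the value 0. *)
Lemma bernstein_sum_deviation {R : realType} (a : nat -> R) (n : nat)
    (x y e C : R) :
  0 <= x <= 1 -> (0 < n)%N -> 0 <= C ->
  (forall k, (k <= n)%N ->
    `|(if (k < n)%N then a k else 0) - y| <= e + C * (k%:R / n%:R - x) ^+ 2) ->
  `|bernstein_sum a n x - y| <= e + C / n%:R.
Proof.
move=> x01 n0 C0 h; have n0' : n%:R != 0 :> R by rewrite pnatr_eq0 -lt0n.
have -> : bernstein_sum a n x - y = \sum_(k < n.+1) binomial_weight n k x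
    * ((if (k < n)%N then a k else 0) - y).
  under eq_bigr do rewrite mulrBr.
  by rewrite sumrB -bernstein_sumE -mulr_suml sum_binomial_weight mul1r.
apply: le_trans (ler_norm_sum _ _ _) _.
apply: (@le_trans _ _ (\sum_(k < n.+1) binomial_weight n k x
    * (e + C * (k%:R / n%:R - x) ^+ 2))).
  apply: ler_sum => k _; rewrite normrM ger0_norm ?binomial_weight_ge0 //.
  by rewrite ler_wpM2l ?binomial_weight_ge0 // h // -ltnS.
have -> : \sum_(k < n.+1) binomial_weight n k x
      * (e + C * (k%:R / n%:R - x) ^+ 2)
    = e + C / n%:R ^+ 2 * \sum_(k < n.+1)
        binomial_weight n k x * (k%:R - n%:R * x) ^+ 2.
  under eq_bigr do rewrite mulrDr.
  rewrite big_split -mulr_suml sum_binomial_weight mul1r mulr_sumr /=.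
  by congr (_ + _); apply: eq_bigr => k _; field.
rewrite binomial_weight_second_moment subrr expr0n /= addr0.
have -> : C / n%:R ^+ 2 * (n%:R * x * (1 - x)) = C / n%:R * (x * (1 - x)).
  by field.
by rewrite lerD2l ler_piMr ?divr_ge0 //; move: x01 => /andP[? ?]; nra.
Qed.

(** * Approximation of continuous functions by Bernstein sums *)

Lemma continuous_bounded01 {R : realType} (g : R -> R) : continuous g ->
  exists2 G : R, 0 <= G & forall x : R, x \in `[0, 1] -> `|g x| <= G.
Proof.
move=> gc; have [c _ cmax] := @EVT_max R (fun x => `|g x|) 0 1 ler01
  (continuous_subspaceT (fun x => cvg_norm (gc x))).
by exists `|g c|.
Qed.

(* Uniform continuity in the shape needed by the second-moment estimate. *)
Lemma continuous_quadratic_modulus {R : realType} (g : R -> R) (e : R) :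
  continuous g -> 0 < e -> exists2 C : R, 0 <= C &
    forall x y : R, x \in `[0, 1] -> y \in `[0, 1] ->
      `|g y - g x| <= e + C * (y - x) ^+ 2.
Proof.
move=> gc e0.
have [G G0 Gb] := continuous_bounded01 _ gc.
have /compact_near_coveringP cov := @segment_compact R 0 1.
(* With a natural number as constant, the near-covering form of compactness turns constants valid
   near each point into one valid on all of [[0, 1]]. *)
pose P (n : nat) (x : R) := x \in `[0, 1] -> forall y : R, y \in `[0, 1] ->
   `|g y - g x| <= e + n%:R * (y - x) ^+ 2.
have [|N _ NP] := cov nat \oo P _.
  move=> x x01.
  have e2 : 0 < e / 2 by rewrite divr_gt0.
  have /cvgrPdist_lt/(_ _ e2) /nbhs_ballP[d /= d0 hd] := gc x.
  have d2 : 0 < d / 2 by rewrite divr_gt0.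
  near=> x' n => /= x'01 y y01.
  have xx' : `|x - x'| < d / 2.
    near: x'; exact: nbhsx_ballx.
  have gx' : `|g x - g x'| < e / 2.
    by apply: hd; rewrite /ball /=; apply: lt_trans xx' _; lra.
  (* Close to [x'] continuity gives the error [e]; farther away the quadratic term is at least the
     trivial bound [2 * G]. *)
  have [yx'|yx'] := ltP `|y - x'| (d / 2).
    have gy : `|g x - g y| < e / 2.
      apply: hd; rewrite /ball /= -(subrK x' x) -addrA.
      by apply: le_lt_trans (ler_normD _ _) _; rewrite (distrC x' y); lra.
    have -> : g y - g x' = (g x - g x') - (g x - g y) by ring.
    apply: le_trans (ler_normB _ _) _.
    have : 0 <= n%:R * (y - x') ^+ 2 by rewrite mulr_ge0 ?sqr_ge0.
    by lra.
  have nG : 2 * G / (d / 2) ^+ 2 <= n%:R.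
    by near: n; exact: nbhs_infty_ger.
  apply: le_trans (ler_normB _ _) _.
  have := Gb _ x'01; have := Gb _ y01.
  have : (d / 2) ^+ 2 <= (y - x') ^+ 2.
    by rewrite -(real_normK (num_real (y - x'))) ler_sqr ?nnegrE // ltW.
  rewrite ler_pdivrMr ?exprn_gt0 // in nG.
  move=> h1 h2 h3.
  have : n%:R * (d / 2) ^+ 2 <= n%:R * (y - x') ^+ 2 by rewrite ler_wpM2l.
  by lra.
exists N%:R => //.
by move=> x y x01 y01; apply: (NP N) => //=.
Unshelve. all: by end_near. Qed.

(** [N] depends on [a] only through [m] and [W], so a block end can be fixed before the sequence is
    known. The uncontrolled nodes, [k < m] and [k = n], stay at distance at least [d / 2] from [x],
    so their contribution is of order [1 / n]. *)
Lemma bernstein_sum_approx {R : realType} (g : R -> R) (m : nat) (W e d : R) :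
  continuous g -> 0 < e -> 0 < d ->
  exists N : nat, forall (n : nat) (a : nat -> R), (N <= n)%N ->
    (forall k, (k < m)%N -> `|a k| <= W) ->
    (forall k, (m <= k < n)%N -> a k = g (k%:R / n%:R)) ->
    forall x : R, x \in `[d, 1 - d] -> `|bernstein_sum a n x - g x| <= e.
Proof.
move=> gc e0 d0.
have e2 : 0 < e / 2 by rewrite divr_gt0.
have [G G0 Gb] := continuous_bounded01 _ gc.
have [C C0 gmod] := continuous_quadratic_modulus _ _ gc e2.
(* From distance [d / 2] on, the factor [(2 / d) ^+ 2] lifts the quadratic term to [|W| + G], which
   bounds the difference at uncontrolled nodes. *)
pose D := C + (`|W| + G) * (2 / d) ^+ 2.
have D0 : 0 <= D.
  by apply: addr_ge0 => //; apply: mulr_ge0; rewrite ?sqr_ge0 ?addr_ge0.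
pose N := maxn 1 (maxn (Num.truncn (2 * m%:R / d)).+1
  (Num.truncn (D / (e / 2))).+1).
exists N => n a; rewrite !geq_max => /and3P[n0 nm nD] am ag x.
rewrite in_itv /= => /andP[dx xd].
have n0' : 0 < n%:R :> R by rewrite ltr0n.
have {}nm : 2 * m%:R <= n%:R * d.
  by rewrite -ler_pdivrMr // ltW // (lt_le_trans (truncnS_gt _)) ?ler_nat.
have {}nD : D <= n%:R * (e / 2).
  by rewrite -ler_pdivrMr // ltW // (lt_le_trans (truncnS_gt _)) ?ler_nat.
have x01 : 0 <= x <= 1 by apply/andP; split; lra.
have gx : `|g x| <= G by apply: Gb; rewrite in_itv.
apply: (@le_trans _ _ (e / 2 + D / n%:R)); last first.
  have : D / n%:R <= e / 2 by rewrite ler_pdivrMr // mulrC.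
  by lra.
apply: bernstein_sum_deviation => // k kn.
have kn01 : 0 <= (k%:R / n%:R : R) <= 1.
  by rewrite divr_ge0 //= ler_pdivrMr // mul1r ler_nat.
have W0 := normr_ge0 W.
have far b : `|b| <= `|W| -> d / 2 <= `|k%:R / n%:R - x| ->
    `|b - g x| <= e / 2 + D * (k%:R / n%:R - x) ^+ 2.
  move=> bW; set t := _ - x => dt.
  have t1 : 1 <= (2 / d) ^+ 2 * t ^+ 2.
    rewrite -(real_normK (num_real t)) -exprMn -{1}(expr1n R 2).
    rewrite ler_sqr ?nnegrE ?mulr_ge0 //; last by rewrite invr_ge0 ltW.
    by rewrite mulrAC ler_pdivlMr // mul1r; lra.
  apply: le_trans (ler_normB _ _) _.
  have : 0 <= C * t ^+ 2 by rewrite mulr_ge0 ?sqr_ge0.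
  have : `|W| + G <= (`|W| + G) * ((2 / d) ^+ 2 * t ^+ 2).
    by rewrite ler_peMr // addr_ge0.
  by rewrite /D mulrDl -mulrA; lra.
have [kltn|kgen] := ltnP k n; last first.
  apply: far; first by rewrite normr0.
  have -> : k = n by apply/eqP; rewrite eqn_leq kn.
  by rewrite divff ?gt_eqF // ger0_norm; lra.
have [km|mk] := ltnP k m.
  apply: far; first by apply: le_trans (am _ km) (ler_norm _).
  have : k%:R / n%:R <= d / 2.
    rewrite ler_pdivrMr //; have : k%:R <= m%:R :> R by rewrite ler_nat ltnW.
    by lra.
  by move=> ?; rewrite distrC ger0_norm; lra.
rewrite ag ?mk //.
apply: le_trans (gmod _ _ _ _) _; rewrite ?in_itv //.
rewrite lerD2l ler_wpM2r ?sqr_ge0 // /D lerDl.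
by rewrite mulr_ge0 ?sqr_ge0 ?addr_ge0.
Qed.

(** * Uniform convergence on compact sets and stability of Bernstein sums *)

Lemma uniform_cvgP {R : realType} (K : set R) (F : nat -> R -> R) (f : R -> R) :
  {uniform K, F @ \oo --> f} <->
  forall e : R, 0 < e ->
    \forall n \near \oo, forall x, K x -> `|F n x - f x| < e.
Proof.
split=> [Ff e e0|h P /uniform_nbhs[E [entE EP]]].
  apply: (Ff [set g | forall x, K x -> `|g x - f x| < e]).
  apply/uniform_nbhs; exists [set xy : R * R | ball xy.1 e xy.2].
  split; first exact: entourage_ball (PosNum e0).
  by move=> g gE x Kx; rewrite distrC; apply: gE.
move: entE; rewrite -entourage_ballE => -[e /= e0 eE].
have := h e e0; apply: filterS => n nE; apply: EP => x Kx.
by apply: eE; rewrite /= /ball /= distrC nE.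
Qed.

(** The weights are nonnegative with sum 1, so the sum is a contraction for the sup norm of the
    coefficients. *)
Lemma leB_bernstein_sum {R : realType} (a b : nat -> R) (n : nat) (x e : R) :
  0 <= x <= 1 -> 0 <= e -> (forall k, (k < n)%N -> `|a k - b k| <= e) ->
  `|bernstein_sum a n x - bernstein_sum b n x| <= e.
Proof.
move=> x01 e0 ab; rewrite !bernstein_sumE -sumrB.
apply: le_trans (ler_norm_sum _ _ _) _.
rewrite -[leRHS]mul1r -(sum_binomial_weight n x) mulr_suml.
apply: ler_sum => k _; rewrite -mulrBr normrM.
rewrite (ger0_norm (binomial_weight_ge0 _ _ _ x01)).
rewrite ler_wpM2l ?binomial_weight_ge0 //.
by case: ifP => [/ab //|_]; rewrite subr0 normr0.
Qed.

Lemma bernstein_sumZ {R : realType} (c : R) (a : nat -> R) (n : nat) (x : R) :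
  bernstein_sum (fun k => c * a k) n x = c * bernstein_sum a n x.
Proof. by rewrite mulr_sumr; apply: eq_bigr => k _; ring. Qed.

Lemma continuous_bernstein_sum {R : realType} (a : nat -> R) (n : nat) :
  continuous (bernstein_sum a n).
Proof.
pose p : {poly R} :=
  \sum_(k < n) ('C(n, k)%:R * a k) *: ('X ^+ k * (1 - 'X) ^+ (n - k)).
have -> : bernstein_sum a n = horner p; last exact: continuous_horner.
apply/funext => x; rewrite horner_sum; apply: eq_bigr => k _.
by rewrite !hornerE.
Qed.

Definition itv_exhaustion (R : realType) (i : nat) : set R :=
  `[i.+1%:R^-1, 1 - i.+1%:R^-1].

Lemma itv_exhaustion01 {R : realType} (i : nat) (x : R) :
  itv_exhaustion R i x -> 0 <= x <= 1.
Proof.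
rewrite /itv_exhaustion /= in_itv /= => /andP[x0 x1].
have : 0 < i.+1%:R^-1 :> R by rewrite invr_gt0.
move: (_^-1) x0 x1 => t x0 x1 t0.
by apply/andP; split; lra.
Qed.

Lemma sub_itv_exhaustion {R : realType} (i j : nat) :
  (i <= j)%N -> itv_exhaustion R i `<=` itv_exhaustion R j.
Proof.
move=> ij x; rewrite /itv_exhaustion /= !in_itv /= => /andP[x0 x1].
have : j.+1%:R^-1 <= i.+1%:R^-1 :> R by rewrite lef_pV2 ?posrE // ler_nat.
move: (i.+1%:R^-1) (j.+1%:R^-1) x0 x1 => t u x0 x1 ut.
by apply/andP; split; lra.
Qed.

Lemma compact_sub_itv_exhaustion {R : realType} (K : set R) :
  compact K -> K `<=` `]0, 1[ ->
  \forall i \near \oo, K `<=` itv_exhaustion R i.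
Proof.
move=> /compact_near_coveringP cov K01.
apply: (cov nat \oo (itv_exhaustion R)) => /= x /K01 /=.
rewrite in_itv /= => /andP[x0 x1].
have [m m0 [mx mx1]] : exists2 m : R, 0 < m / 2 & m <= x /\ m <= 1 - x.
  exists (Num.min x (1 - x)); first by rewrite divr_gt0 // lt_min x0 subr_gt0.
  by rewrite !ge_min !lexx orbT.
near=> x' i => /=.
have xx' : `|x - x'| < m / 2 by near: x'; exact: nbhsx_ballx.
have id : i.+1%:R^-1 < m / 2.
  by near: i; exact: (near_infty_natSinv_lt (PosNum m0)).
move: xx'; rewrite ltr_norml => /andP[? ?].
rewrite /itv_exhaustion /= in_itv /=; move: (_^-1) id => t id.
by apply/andP; split; lra.
Unshelve. all: by end_near. Qed.

(** * A countable dense family of targets *)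

Definition rat_bernstein {R : realType} (s : seq rat) : R -> R :=
  bernstein_sum (fun k => ratr s`_k) (size s).

(** A Bernstein sum with sampled real coefficients comes within [e / 2] of [f], and rounding these
    coefficients to rationals costs at most another [e / 2]. *)
Lemma rat_bernstein_dense {R : realType} (f : R -> R) (d e : R) :
  {within `]0, 1[, continuous f} -> 0 < d -> 0 < e ->
  exists s : seq rat, forall x, x \in `[d, 1 - d] ->
    `|rat_bernstein s x - f x| <= e.
Proof.
move=> fc d0 e0.
have e2 : 0 < e / 2 by rewrite divr_gt0.
have [d1|d1] := leP d (1 - d); last first.
  exists [::] => x; rewrite in_itv /= => /andP[? ?]; lra.
(* Clamping to [d, 1 - d] makes f continuous on all of R. *)
pose p (x : R) := Num.max d (Num.min x (1 - d)).
have p01 x : `]0, 1[%classic (p x).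
  rewrite /= in_itv /= /p lt_max d0 /= gt_max gt_min.
  by apply/andP; split; [lra|apply/orP; right; lra].
have gc : continuous (f \o p).
  move=> x; apply: continuous_comp.
    apply: continuous_max; first exact: cvg_cst.
    by apply: continuous_min; [exact: cvg_id|exact: cvg_cst].
  move: fc; rewrite continuous_open_subspace; last exact: interval_open.
  by apply; exact/mem_set/p01.
have [n nP] := bernstein_sum_approx _ 0 0 _ _ gc e2 d0.
pose a k := (f \o p) (k%:R / n%:R).
have /choice[r rP] : forall k, exists q : rat, `|ratr q - a k| <= e / 2.
  move=> k; have [q] := @rat_in_itvoo R (a k) (a k + e / 2) ltac:(lra).
  rewrite in_itv /= => /andP[? ?]; exists q.
  by rewrite ger0_norm; lra.
exists (mkseq r n) => x xd.
have [x0 x1] : d <= x /\ x <= 1 - d by move: xd; rewrite in_itv => /andP.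
have fx : f x = (f \o p) x.
  by rewrite /= /p min_l // max_r.
rewrite fx /rat_bernstein size_mkseq.
set b := (fun k : nat => ratr (mkseq r n)`_k).
rewrite -(subrK (bernstein_sum a n x) (bernstein_sum b n x)) -addrA.
apply: le_trans (ler_normD _ _) _.
rewrite [leRHS](splitr e); apply: lerD.
  apply: leB_bernstein_sum; [apply/andP; split; lra|exact: ltW|].
  by move=> k kn; rewrite /b nth_mkseq.
by apply: nP.
Qed.

(** * Universality as a countable intersection *)

Lemma increasing_seq_ge_id (u : nat -> nat) (n : nat) :
  increasing_seq u -> (n <= u n)%N.
Proof.
move=> /leqW_mono u_incr; elim: n => // n IHn.
by apply: leq_ltn_trans IHn _; rewrite u_incr.
Qed.

(* The margin [e < 1 / (i + 1)] makes this set open without having to know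
   that the supremum over the compact interval is attained. *)
Definition rat_bernstein_nbhs (R : realType) (mu : nat -> nat)
    (p : seq rat * nat) : set {ptws nat -> R} :=
  [set a : nat -> R | exists n, [/\ range mu n, (p.2 <= n)%N &
    exists2 e : R, e < p.2.+1%:R^-1 &
    forall x, itv_exhaustion R p.2 x ->
      `|bernstein_sum a n x - rat_bernstein p.1 x| <= e]].

Lemma itv_exhaustion_sub01 {R : realType} (i : nat) :
  itv_exhaustion R i `<=` `]0, 1[.
Proof.
move=> x; rewrite /itv_exhaustion /= !in_itv /=.
have : 0 < i.+1%:R^-1 :> R by rewrite invr_gt0.
by move: (_^-1) => t t0 /andP[x0 x1]; apply/andP; split; lra.
Qed.

(** The rational target is a polynomial, hence an admissible [f]; a late index of its approximating
    subsequence is the witness. *)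
Lemma universal_seqs_sub_nbhs {R : realType} (mu : nat -> nat) p :
  universal_seqs R mu `<=` rat_bernstein_nbhs R mu p.
Proof.
case: p => s i a aU.
have [|lambda [lincr lmu] lcvg] := aU (rat_bernstein s).
  by apply: continuous_subspaceT; exact: continuous_bernstein_sum.
have i0 : 0 < i.+1%:R^-1 / 2 :> R by rewrite divr_gt0.
have /uniform_cvgP/(_ _ i0)[N _ NP] :=
  lcvg _ (@segment_compact R _ _) (itv_exhaustion_sub01 i).
exists (lambda (maxn N i)); split.
- by apply: lmu; exists (maxn N i).
- exact: leq_trans (leq_maxr N i) (increasing_seq_ge_id _ _ lincr).
exists (i.+1%:R^-1 / 2).
  by rewrite /=; move: (_^-1) i0 => t t0; lra.
by move=> x xi; apply/ltW; apply: NP => //=; exact: leq_maxl.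
Qed.

(** Diagonal choice: the index at stage [i] serves the [i]-th compact interval with error below
    [2 / (i + 1)] and exceeds the previous index. Each compact subset of (0, 1) lies in these
    intervals from some stage on. *)
Lemma bigcap_sub_universal_seqs {R : realType} (mu : nat -> nat) :
  \bigcap_p rat_bernstein_nbhs R mu p `<=` universal_seqs R mu.
Proof.
move=> a aU f fc.
have step i N : exists n, [/\ range mu n, (N < n)%N &
    forall x, itv_exhaustion R i x ->
      `|bernstein_sum a n x - f x| < 2 * i.+1%:R^-1].
  (* [j >= i] controls the interval and both errors, while [j > N] forces the index beyond [N]. *)
  pose j := maxn i N.+1.
  have j0 : 0 < j.+1%:R^-1 :> R by rewrite invr_gt0.
  have [s sP] := rat_bernstein_dense f _ _ fc j0 j0.
  have [n [/= nmu jn [e ej nP]]] := aU (s, j) I.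
  exists n; split=> //; first exact: leq_trans (leq_maxr _ _) jn.
  move=> x xi; have xj := sub_itv_exhaustion _ _ (leq_maxl i N.+1) _ xi.
  have ij : j.+1%:R^-1 <= i.+1%:R^-1 :> R.
    by rewrite lef_pV2 ?posrE // ler_nat ltnS leq_maxl.
  have := ler_normD (bernstein_sum a n x - rat_bernstein s x)
                    (rat_bernstein s x - f x).
  rewrite addrA subrK; have := nP _ xj; have := sP _ xj.
  by move: (i.+1%:R^-1) (j.+1%:R^-1) ij ej => t u tu eu; lra.
have /choice[F FP] : forall iN : nat * nat, exists n, [/\ range mu n,
    (iN.2 < n)%N & forall x, itv_exhaustion R iN.1 x ->
      `|bernstein_sum a n x - f x| < 2 * iN.1.+1%:R^-1].
  by move=> iN; exact: step.
pose fix lambda i := if i is j.+1 then F (i, lambda j) else F (0, 0).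
have lambdaP i : exists N, lambda i = F (i, N) by case: i; eexists.
exists lambda.
  split.
    apply: leq_mono; apply: homo_ltn; first exact: ltn_trans.
    by move=> i; have [_ + _] := FP (i.+1, lambda i).
  by move=> _ [i _ <-]; have [N ->] := lambdaP i; have [] := FP (i, N).
move=> K Kc K01; apply/uniform_cvgP => e e0.
have e2 : 0 < e / 2 by rewrite divr_gt0.
near=> i => x Kx.
have xi : itv_exhaustion R i x.
  by move: x Kx; near: i; exact: compact_sub_itv_exhaustion.
have ie : i.+1%:R^-1 < e / 2.
  by near: i; exact: (near_infty_natSinv_lt (PosNum e2)).
have [N ->] := lambdaP i; have [_ _ /(_ x xi)] := FP (i, N).
by rewrite /=; move: (_^-1) ie => t te h; lra.
Unshelve. all: by end_near. Qed.

Lemma universal_seqsE {R : realType} (mu : nat -> nat) :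
  universal_seqs R mu = \bigcap_p rat_bernstein_nbhs R mu p.
Proof.
apply/seteqP; split; last exact: bigcap_sub_universal_seqs.
by move=> a aU p _; exact: universal_seqs_sub_nbhs.
Qed.

(** * Open and dense sets in the product topology *)

Lemma nbhs_ptws_coord {R : realType} (a : {ptws nat -> R}) (n : nat) (e : R) :
  0 < e -> nbhs a [set b : {ptws nat -> R} | `|b n - a n| < e].
Proof.
move=> e0.
rewrite (_ : [set b : {ptws _ -> _} | _] = proj n @^-1` ball (a n) e).
  exact: (@proj_continuous nat (fun=> R) n a _ (nbhsx_ballx (a n) e e0)).
by apply/funext => b; rewrite /ball /= distrC.
Qed.

Lemma nbhs_ptws_prefix {R : realType} (a : {ptws nat -> R}) (n : nat) (e : R) :
  0 < e ->
  nbhs a [set b : {ptws nat -> R} | forall k, (k < n)%N -> `|b k - a k| < e].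
Proof.
move=> e0; elim: n => [|n IHn]; first by apply: filterS filterT => b _ k.
apply: filterS2 (nbhs_ptws_coord a n e e0) IHn => b bn bk k.
by rewrite ltnS leq_eqVlt => /predU1P[->|/bk].
Qed.

(** Points of [S] that agree with [t] on longer and longer prefixes converge to [t]: along them each
    coordinate is eventually constant. *)
Lemma ptws_dense_prefix {R : realType} (S : set {ptws nat -> R}) :
  (forall (t : nat -> R) (n : nat),
    exists2 v, S v & forall k, (k < n)%N -> v k = t k) ->
  dense S.
Proof.
move=> St O [t Ot] Oo.
have /choice[v vP] : forall n, exists v,
    S v /\ forall k, (k < n)%N -> v k = t k.
  by move=> n; have [v] := St t n; exists v.
have vt : {ptws, v @ \oo --> (t : nat -> R)}.
  apply/pointwise_cvgP => k; apply: cvg_near_cst.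
  by exists k.+1 => // n /= kn; exact: (vP n).2.
have [N _ NO] := vt O (open_nbhs_nbhs (conj Oo Ot)).
by exists (v N); split; [apply: NO => /=|apply: (vP N).1].
Qed.

Lemma open_rat_bernstein_nbhs {R : realType} (mu : nat -> nat) p :
  open (rat_bernstein_nbhs R mu p).
Proof.
rewrite openE => a [n [nmu pn [e ep aP]]].
(* Half of the spare margin is spent on moving the first [n] coordinates, the only ones that the sum
   sees. *)
have d0 : 0 < (p.2.+1%:R^-1 - e) / 2 by rewrite divr_gt0 // subr_gt0.
apply: filterS (nbhs_ptws_prefix a n _ d0) => b ba.
exists n; split=> //; exists (e + (p.2.+1%:R^-1 - e) / 2).
  by move: (_^-1) ep => t; lra.
move=> x xp; rewrite -(subrK (bernstein_sum a n x) (bernstein_sum b n x)).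
rewrite -addrA addrC; apply: le_trans (ler_normD _ _) _.
apply: lerD; first exact: aP.
apply: leB_bernstein_sum (itv_exhaustion01 _ _ xp) (ltW d0) _ => k kn.
exact/ltW/ba.
Qed.

Lemma Gdelta_universal_seqs {R : realType} (mu : nat -> nat) :
  Gdelta (universal_seqs R mu).
Proof.
(* Numbers that decode to nothing receive [([::], 0)], which repeats a member of the family and
   leaves the intersection unchanged. *)
exists (fun k => rat_bernstein_nbhs R mu (odflt ([::], 0%N) (unpickle k))).
  by move=> k; exact: open_rat_bernstein_nbhs.
rewrite universal_seqsE; apply/seteqP; split=> a aP p _; first exact: aP.
by have := aP (pickle p) I; rewrite /= pickleK.
Qed.

(** * The block construction and its universality *)

Lemma injective_nat_unbounded (u : nat -> nat) (N : nat) :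
  injective u -> exists d, (N <= u d)%N.
Proof.
move=> u_inj; apply: contrapT => /forallNP uN.
have : (size [seq u d | d <- iota 0 N.+1] <= size (iota 0 N))%N.
  apply: uniq_leq_size; first by rewrite map_inj_uniq ?iota_uniq.
  move=> _ /mapP[d _ ->].
  by rewrite mem_iota leq0n add0n ltnNge; apply/negP/uN.
by rewrite size_map !size_iota ltnn.
Qed.

(* J k is the coordinate to which the block containing k is devoted; the test
   J k < k makes the map c |-> block_transform J w c unitriangular. *)
Definition block_transform {R : realType} (J : nat -> nat) (w c : nat -> R) :
    nat -> R :=
  fun k => c k + (if (J k < k)%N then c (J k) else 0) * w k.

(** Forward substitution: entry [n] involves only [c n] and an earlier entry of [c], so choosing
    [c n] corrects it without disturbing the entries before it. *)
Lemma block_transform_prefix {R : realType} (J : nat -> nat) (w : nat -> R)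
    (t : nat -> R) (n : nat) :
  exists c : nat -> R, (forall k, (n <= k)%N -> c k = 0) /\
    forall k, (k < n)%N -> block_transform J w c k = t k.
Proof.
elim: n => [|n [c [c0 ct]]]; first by exists (fun=> 0).
exists (fun k => if k == n then t n - block_transform J w c n else c k).
split=> [k nk|k]; first by rewrite gtn_eqF // c0 // ltnW.
rewrite ltnS leq_eqVlt => /predU1P[->|kn].
  rewrite /block_transform eqxx c0 //.
  by case: ltnP => [Jn|_]; [rewrite ltn_eqF //|]; ring.
rewrite -(ct k) // /block_transform /= ltn_eqF //; case: ltnP => //= Jk.
by rewrite ltn_eqF // (ltn_trans Jk).
Qed.

Lemma nat_blocks (m : nat -> nat) : m 0 = 0%N ->
  (forall t, (m t < m t.+1)%N) -> exists b : nat -> nat,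
    forall k t, (m t <= k < m t.+1)%N = (b k == t).
Proof.
move=> m0 m_lt; have m_le : {homo m : x y / (x <= y)%N}.
  by apply: homo_leq leqnn leq_trans _ => t; exact/ltnW.
have /choice[b bP] : forall k, exists t, (m t <= k < m t.+1)%N.
  elim=> [|k [t /andP[tk kt]]]; first by exists 0; rewrite m0 /= -{1}m0.
  move: kt; rewrite leq_eqVlt => /predU1P[kt|kt].
    by exists t.+1; rewrite kt leqnn m_lt.
  by exists t; rewrite leqW.
exists b => k t; apply/idP/eqP => [/andP[tk kt]|<-//].
have /andP[bk kb] := bP k; apply/eqP; rewrite eqn_leq -ltnS -[(t <= b k)%N]ltnS.
apply/andP; split; rewrite ltnNge; apply/negP => /m_le h.
  by have := leq_trans (leq_trans kt h) bk; rewrite ltnn.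
by have := leq_trans (leq_trans kb h) tk; rewrite ltnn.
Qed.

Lemma block_transform_universal {R : realType} (mu : nat -> nat) :
  increasing_seq mu -> exists (J : nat -> nat) (w : nat -> R),
  forall (c : nat -> R) (M j : nat), (forall k, (M <= k)%N -> c k = 0) ->
    c j != 0 -> universal_seqs R mu (block_transform J w c).
Proof.
move=> mu_incr.
(* The discarded third component makes every pair occur for infinitely many t. *)
pose code t : nat * seq rat :=
  if unpickle t is Some p then (p : nat * seq rat * nat).1 else (0%N, [::]).
pose q t : R -> R := rat_bernstein (code t).2.
have qc t : continuous (q t) by exact: continuous_bernstein_sum.
have /choice[bd bdP] : forall t, exists B : R,
    0 <= B /\ forall x : R, x \in `[0, 1] -> `|q t x| <= B.
  by move=> t; have [B] := continuous_bounded01 _ (qc t); exists B.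
pose sumbd t := \sum_(i < t) bd i.
have bd_sum t u : (t < u)%N -> bd t <= sumbd u.
  move=> tu; rewrite /sumbd (bigD1 (Ordinal tu)) //= lerDl.
  by apply: sumr_ge0 => i _; exact: (bdP i).1.
have sum0 t : 0 <= sumbd t by apply: sumr_ge0 => i _; exact: (bdP i).1.
have inv0 t : 0 < t.+1%:R^-1 :> R by rewrite invr_gt0.
(* Block ends must be chosen before [c] is known. After division by [c j] the earlier entries are
   bounded by a constant depending on [c] times [1 + sumbd t]; the factor [t] dominates this
   constant once [t] is large. *)
have /choice[next nextP] : forall tm : nat * nat, exists n,
    [/\ range mu n, (tm.2 < n)%N & forall a : nat -> R,
      (forall k, (k < tm.2)%N -> `|a k| <= tm.1%:R * (1 + sumbd tm.1)) ->
      (forall k, (tm.2 <= k < n)%N -> a k = q tm.1 (k%:R / n%:R)) ->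
      forall x, itv_exhaustion R tm.1 x ->
        `|bernstein_sum a n x - q tm.1 x| <= tm.1.+1%:R^-1].
  case=> t m /=.
  have [N NP] := bernstein_sum_approx _ m (t%:R * (1 + sumbd t)) _ _
    (qc t) (inv0 t) (inv0 t).
  exists (mu (maxn N m.+1)); have le_mu := increasing_seq_ge_id _ _ mu_incr.
  split; first by exists (maxn N m.+1).
    exact: leq_trans (leq_maxr N _) (le_mu _).
  by move=> a; apply: NP; exact: leq_trans (leq_maxl _ m.+1) (le_mu _).
pose fix m t := if t is u.+1 then next (u, m u) else 0%N.
have m_lt t : (m t < m t.+1)%N by have [] := nextP (t, m t).
have m_ge t : (t <= m t)%N by elim: t => // t IHt; exact: leq_ltn_trans IHt _.
have [b bP] := nat_blocks _ erefl m_lt.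
(* The nodes are scaled by the right end of the block, which is the order of the sum to be
   evaluated. *)
exists (fun k => (code (b k)).1), (fun k => q (b k) (k%:R / (m (b k).+1)%:R)).
move=> c M j cM cj; set v := block_transform _ _ _.
apply: bigcap_sub_universal_seqs => -[s i] _.
have cj0 : 0 < `|c j| by rewrite normr_gt0.
pose C := \sum_(k < M) `|c k|.
have C0 : 0 <= C by exact: sumr_ge0.
have c_le k : `|c k| <= C.
  have [/cM ->|kM] := leqP M k; first by rewrite normr0.
  by rewrite /C (bigD1 (Ordinal kM)) //= lerDl sumr_ge0.
(* Two errors [eta], multiplied by [|c j|], make half of [1 / (i + 1)], strictly within the
   margin. *)
pose eta := i.+1%:R^-1 / 4 / `|c j|.
have eta0 : 0 < eta by rewrite !divr_gt0.
(* The block reproduces [c j] times its target, so the target is divided by [c j] in advance. *)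
have [|s' s'P] := rat_bernstein_dense (fun x => (c j)^-1 * rat_bernstein s x)
    _ _ _ (inv0 i) eta0.
  apply: continuous_subspaceT => x; apply: cvgM; first exact: cvg_cst.
  exact: continuous_bernstein_sum.
(* Thresholds for [t]: [i] for the interval, [M] so that [c] vanishes on the block, [j.+1] so that
   the test [J k < k] succeeds there, [C / |c j|] for the earlier entries, and [eta^-1] for the
   accuracy. *)
have [d] := injective_nat_unbounded (fun d => pickle ((j, s'), d))
  (maxn (maxn i M) (maxn j.+1
    (maxn (Num.truncn (C / `|c j|)).+1 (Num.truncn eta^-1).+1)))
  ltac:(by move=> d d' /(pcan_inj pickleK)[]).
set t := pickle _; rewrite !geq_max => /and3P[/andP[it Mt] jt /andP[Ct et]].
have codet : code t = (j, s') by rewrite /code pickleK.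
have {}Ct : C / `|c j| <= t%:R.
  by rewrite ltW // (lt_le_trans (truncnS_gt _)) ?ler_nat.
have {}et : t.+1%:R^-1 <= eta.
  rewrite -[eta]invrK lef_pV2 ?posrE ?invr_gt0 //.
  by rewrite ltW // (lt_le_trans (truncnS_gt _)) // ler_nat ltnW.
have [nmu mn approx] := nextP (t, m t).
exists (next (t, m t)); split=> //.
  exact: leq_trans it (leq_trans (m_ge t) (ltnW mn)).
exists (i.+1%:R^-1 / 2); first by move: (_^-1) (inv0 i) => u u0 /=; lra.
move=> x xi.
have {}approx : `|bernstein_sum (fun k => (c j)^-1 * v k) (m t.+1) x - q t x|
    <= t.+1%:R^-1.
  apply: approx => [k /= km|k /=|]; last exact: sub_itv_exhaustion it _ xi.
    have /andP[bk kb] : (m (b k) <= k < m (b k).+1)%N by rewrite bP.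
    have bt : (b k < t)%N.
      rewrite ltnNge; apply/negP => tb; have := leq_ltn_trans bk km.
      by rewrite ltnNge (homo_leq leqnn leq_trans (fun t => ltnW (m_lt t)) tb).
    pose w := q (b k) (k%:R / (m (b k).+1)%:R).
    have wsum : `|w| <= sumbd t.
      apply: le_trans (bd_sum _ _ bt); apply: (bdP _).2.
      by rewrite in_itv /= divr_ge0 //= ler_pdivrMr ?mul1r ?ler_nat ?ltr0n
        ?(leq_ltn_trans _ kb) // ltnW.
    have vC : `|v k| <= C * (1 + sumbd t).
      rewrite mulrDr mulr1 /v /block_transform -/w.
      apply: le_trans (ler_normD _ _) _; apply: lerD => //.
      by rewrite normrM ler_pM //; case: ifP => // _; rewrite normr0.
    rewrite normrM normfV mulrC ler_pdivrMr //.
    apply: le_trans vC _; rewrite mulrAC ler_wpM2r ?addr_ge0 //.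
    by rewrite -ler_pdivrMr.
  rewrite -/(m t.+1) bP => /[dup] /eqP bk; rewrite -bP => /andP[mk _].
  have tk := leq_trans (m_ge t) mk.
  rewrite /v /block_transform bk codet /= (leq_trans jt tk) (cM k).
    by rewrite add0r mulKf.
  exact: leq_trans Mt tk.
have vx : bernstein_sum v (m t.+1) x
    = c j * bernstein_sum (fun k => (c j)^-1 * v k) (m t.+1) x.
  by rewrite bernstein_sumZ mulVKf.
rewrite -/(m t.+1) vx /=.
have -> : rat_bernstein s x = c j * ((c j)^-1 * rat_bernstein s x).
  by rewrite mulVKf.
rewrite -mulrBr normrM.
have le2 : `|bernstein_sum (fun k => (c j)^-1 * v k) (m t.+1) x
    - (c j)^-1 * rat_bernstein s x| <= eta + eta.
  rewrite -(subrK (q t x) (bernstein_sum _ _ _)) -addrA.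
  apply: le_trans (ler_normD _ _) _; apply: lerD.
    by apply: le_trans et; exact: approx.
  by rewrite /q codet; apply: s'P.
apply: le_trans (ler_wpM2l (normr_ge0 _) le2) _.
have -> : `|c j| * (eta + eta) = i.+1%:R^-1 / 2.
  by rewrite /eta; move: (i.+1%:R^-1) => u; field; rewrite gt_eqF.
by [].
Qed.

Theorem proposition3p3 (R : realType) (mu : nat -> nat)
    (mu_incr : increasing_seq mu) :
  [/\ universal_seqs R mu !=set0,
      dense (universal_seqs R mu),
      Gdelta (universal_seqs R mu) &
      exists V : set {ptws nat -> R},
        [/\ linear_subspace V, dense V &
            V `\` [set (fun=> 0)] `<=` universal_seqs R mu]].
Proof.
have [J [w univ]] := @block_transform_universal R mu mu_incr.
pose V : set {ptws nat -> R} := [set v | exists (c : nat -> R) (M : nat),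
  (forall k, (M <= k)%N -> c k = 0) /\ v = block_transform J w c].
have V_univ : V `\` [set (fun=> 0)] `<=` universal_seqs R mu.
  move=> _ [[c [M [cM ->]]] v0].
  have [j cj] : exists j, c j != 0.
    apply: contrapT => /forallNP c0; apply: v0; apply/funext => k /=.
    have {}c0 l : c l = 0 by apply/eqP/negP => /negP /c0.
    by rewrite /block_transform !c0 if_same; ring.
  exact: univ cM cj.
have V_prefix (t : nat -> R) n :
    exists2 v, V v & forall k, (k < n)%N -> v k = t k.
  have [c [c0 ct]] := block_transform_prefix J w t n.
  by exists (block_transform J w c) => //; exists c, n.
have U_dense : dense (universal_seqs R mu).
  apply: ptws_dense_prefix => t n.
  (* The value 1 prescribed at the extra coordinate [n] keeps [v] from being zero. *)
  pose t' k := if k == n then 1 else t k.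
  have [v Vv vt'] := V_prefix t' n.+1.
  exists v; last by move=> k kn; rewrite vt' ?leqW // /t' ltn_eqF.
  apply: V_univ; split=> // v0; have := vt' n (leqnn _).
  by rewrite v0 /t' eqxx => /eqP; rewrite eq_sym oner_eq0.
split=> //.
- have [||v [_ Uv]] := U_dense setT; last by exists v.
    by exists (fun=> 0).
  exact: openT.
- exact: Gdelta_universal_seqs.
exists V; split=> //; last exact: ptws_dense_prefix.
split; first by apply/mem_set; exists (fun=> 0), 0%N; split=> //;
  apply/funext => k; by rewrite /block_transform if_same mul0r addr0.
move=> r u v /set_mem[c [M [cM ->]]] /set_mem[d [N [dN ->]]].
apply/mem_set; exists (fun k => r * c k + d k), (maxn M N); split.
  by move=> k; rewrite geq_max => /andP[/cM -> /dN ->]; ring.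
apply/funext => k; rewrite /block_transform /=.
rewrite -[LHS]/(r * (c k + _) + (d k + _)).
by case: ifP => _; ring.
Qed.
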